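(* Let $M$ be a skew-symmetric or symmetric $V\times V$ matrix over a field $\mathbb{F}$. Let $N$ be a Lagrangian chain-group on $V$ to $K=\mathbb{F}^2$ such that $(M,a,b)$ is a matrix representation of $N$ with supplementary chains $a$ and $b$ on $V$ to $K$. Then for every $X\subseteq V$, \[\operatorname{rk}M[X,V\setminus X]=\lambda_N(X)=|X|-\dim(N\times X).\]
   Context: Skew-symmetric means $M=-M^t$ with all diagonal entries zero; symmetric means $M=M^t$. $K=\mathbb{F}^2$ carries a bilinear form $\langle\,,\,\rangle_K$ equal to $b^+(\binom ab,\binom cd)=ad+bc$ (symmetric) or $b^-(\binom ab,\binom cd)=ad-bc$ (skew-symmetric). Chains on $V$ to $K$ are maps $V\to K$, forming $K^V$ with $\langle f,g\rangle=\sum_x\langle f(x),g(x)\rangle_K$; a chain-group is a subspace of $K^V$; Lagrangian means $\langle f,g\rangle=0$ for all $f,g\in N$ and $\dim N=|V|$. Chains $a,b$ are supplementary if $\langle a(x),a(x)\rangle_K=\langle b(x),b(x)\rangle_K=0$ and $\langle a(x),b(x)\rangle_K=1$ for all $x\in V$. Given $M=(m_{ij})$ skew-symmetric or symmetric and supplementary $a,b$, where $\langle\,,\,\rangle_K$ is skew-symmetric if $M$ is symmetric and symmetric if $M$ is skew-symmetric, let $f_i(i)=m_{ii}a(i)+b(i)$ and $f_i(j)=m_{ij}a(j)$ for $j\ne i$; the span of $\{f_i:i\in V\}$ is a Lagrangian chain-group $N$, and $(M,a,b)$ is called a (general) matrix representation of $N$. $N\times X=\{f\cdot X: f\in N, f(x)=0\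 \forall x\notin X\}$ where $f\cdot X$ is restriction, and $\lambda_N(X)=\frac12(\dim N-\dim(N\times(V\setminus X))-\dim(N\times X))$. *)

(* Defs.v *)
From HB Require Import structures.
From mathcomp Require Import all_boot all_order all_algebra.

Set Implicit Arguments.
Unset Strict Implicit.
Unset Printing Implicit Defensive.

Import GRing.Theory.
Local Open Scope ring_scope.

(* A V x V matrix is indexed by an unordered finite set, hence a function. *)
Definition sym_matrix (F : fieldType) (V : finType) (M : V -> V -> F) : Prop :=
  forall i j, M i j = M j i.

Definition skew_matrix (F : fieldType) (V : finType) (M : V -> V -> F) : Prop :=
  (forall i j, M i j = - M j i) /\ (forall i, M i i = 0).

Definition sub_matrix (F : fieldType) (V : finType) (M : V -> V -> F)
    (X Y : {set V}) : 'M[F]_(#|X|, #|Y|) :=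
  \matrix_(i < #|X|, j < #|Y|) M (enum_val i) (enum_val j).

Variant Ksign := Fplus | Fminus.

Definition formK (F : fieldType) (s : Ksign) (u v : 'cV[F]_2) : F :=
  match s with
  | Fplus => u 0 0 * v 1 0 + u 1 0 * v 0 0
  | Fminus => u 0 0 * v 1 0 - u 1 0 * v 0 0
  end.

Notation chain F V := {ffun V -> 'cV[F]_2}.

Definition chain_form (F : fieldType) (V : finType) (s : Ksign)
    (f g : chain F V) : F :=
  \sum_(x : V) formK s (f x) (g x).

Definition lagrangian (F : fieldType) (V : finType) (s : Ksign)
    (N : {vspace chain F V}) : Prop :=
  (forall f g, f \in N -> g \in N -> chain_form s f g = 0) /\ \dim N = #|V|.

Definition supplementary (F : fieldType) (V : finType) (s : Ksign)
    (a b : chain F V) : Prop :=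
  forall x, [/\ formK s (a x) (a x) = 0, formK s (b x) (b x) = 0
             & formK s (a x) (b x) = 1].

Definition rep_chain (F : fieldType) (V : finType) (M : V -> V -> F)
    (a b : chain F V) (i : V) : chain F V :=
  [ffun j => if j == i then M i i *: a i + b i else M i j *: a j].

(* The form is the skew-symmetric one when M is taken as symmetric, and the   *)
(* symmetric one when M is taken as skew-symmetric; a matrix that is both     *)
(* may be used with either form.                                              *)
Definition matrix_representation (F : fieldType) (V : finType) (s : Ksign)
    (M : V -> V -> F) (a b : chain F V) (N : {vspace chain F V}) : Prop :=
  [/\ match s with Fplus => skew_matrix M | Fminus => sym_matrix M end,
      supplementary s a b
    & N = <<[seq rep_chain M a b i | i <- enum V]>>%VS].

Definition chain_restrict (F : fieldType) (V : finType) (X : {set V})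
    (f : chain F V) : chain F {x : V | x \in X} :=
  [ffun x => f (val x)].

Lemma chain_restrict_is_linear (F : fieldType) (V : finType) (X : {set V}) :
  linear (@chain_restrict F V X).
Proof. by move=> c f g; apply/ffunP=> x; rewrite !ffunE. Qed.

HB.instance Definition _ (F : fieldType) (V : finType) (X : {set V}) :=
  GRing.isLinear.Build F (chain F V) (chain F {x : V | x \in X}) _
    (@chain_restrict F V X) (@chain_restrict_is_linear F V X).

(* The chain-group N x X. *)
Definition chain_minor (F : fieldType) (V : finType) (N : {vspace chain F V})
    (X : {set V}) : {vspace chain F {x : V | x \in X}} :=
  (linfun (chain_restrict X) @: (N :&: lker (linfun (@chain_restrict F V (~: X)))))%VS.

Lemma chain_minorP (F : fieldType) (V : finType) (N : {vspace chain F V})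
    (X : {set V}) (g : chain F {x : V | x \in X}) :
  reflect (exists f, [/\ f \in N, forall x, x \notin X -> f x = 0
                       & g = chain_restrict X f])
          (g \in chain_minor N X).
Proof.
apply: (iffP memv_imgP) => [[f] | [f [fN f0 ->]]].
  rewrite memv_cap memv_ker lfunE /= => /andP[fN /eqP f0] ->.
  exists f; split=> // [x xX|]; last by rewrite lfunE.
  have xC : x \in ~: X by rewrite inE.
  by move/ffunP/(_ (exist _ x xC)): f0; rewrite !ffunE.
exists f; last by rewrite lfunE.
rewrite memv_cap fN memv_ker lfunE /=; apply/eqP/ffunP=> -[x xC].
by rewrite !ffunE f0 //=; move: xC; rewrite inE.
Qed.

(* lambda_N(X), rational-valued because of the factor 1/2. *)
Definition connectivity (F : fieldType) (V : finType) (N : {vspace chain F V})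
    (X : {set V}) : rat :=
  2%:R^-1 * ((\dim N)%:R - (\dim (chain_minor N (~: X)))%:R
             - (\dim (chain_minor N X))%:R).

(* Main.v *)
From HB Require Import structures.
Require Import Defs.
From mathcomp Require Import all_boot all_order all_algebra.
From mathcomp Require Import ring.

(** Write a chain of [N] as [\sum_i c i *: f_i]; its value at [j] is
    [(c M)_j *: a j + c j *: b j].  Since [a j] and [b j] are independent, the
    chain vanishes off [X] iff [c] vanishes off [X] and its restriction to [X] is
    in the left kernel of [M[X, V \ X]].  Hence [N x X] has dimension
    [|X| - rk M[X, V \ X]], and the (skew-)symmetry of [M] makes the rank the
    same for [X] and its complement. *)

Set Implicit Arguments.
Unset Strict Implicit.
Unset Printing Implicit Defensive.

Import GRing.Theory.
Local Open Scope ring_scope.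

Section ChainMinorDimension.

Variables (F : fieldType) (V : finType) (s : Ksign) (M : V -> V -> F).
Variables (a b : chain F V).
Hypothesis hab : supplementary s a b.

(** Pairing [p *: a x + q *: b x] with [b x] isolates [p], and pairing it with [a x] isolates [q].
    For [Fplus] the self-pairings are removed by isotropy; for [Fminus] they cancel identically. *)
Lemma supplementary_free (x : V) (p q : F) :
  p *: a x + q *: b x = 0 -> p = 0 /\ q = 0.
Proof.
move=> h; have [] := hab x.
have /matrixP/(_ 0 0) := h; have /matrixP/(_ 1 0) := h.
rewrite !mxE /formK; move: (a x 0 0) (a x 1 0) (b x 0 0) (b x 1 0).
move=> a0 a1 b0 b1 h1 h0 ha hb h1ab; case: s ha hb h1ab => ha hb h1ab.
- split.
    transitivity (p * (a0 * b1 + a1 * b0)); first by rewrite h1ab mulr1.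
    transitivity ((p * a0 + q * b0) * b1 + (p * a1 + q * b1) * b0
                  - q * (b0 * b1 + b1 * b0)); first by ring.
    by rewrite h0 h1 hb; ring.
  transitivity (q * (a0 * b1 + a1 * b0)); first by rewrite h1ab mulr1.
  transitivity (a0 * (p * a1 + q * b1) + a1 * (p * a0 + q * b0)
                - p * (a0 * a1 + a1 * a0)); first by ring.
  by rewrite h0 h1 ha; ring.
- split.
    transitivity (p * (a0 * b1 - a1 * b0)); first by rewrite h1ab mulr1.
    transitivity ((p * a0 + q * b0) * b1 - (p * a1 + q * b1) * b0);
      first by ring.
    by rewrite h0 h1; ring.
  transitivity (q * (a0 * b1 - a1 * b0)); first by rewrite h1ab mulr1.
  transitivity (a0 * (p * a1 + q * b1) - a1 * (p * a0 + q * b0));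
    first by ring.
  by rewrite h0 h1; ring.
Qed.

Lemma rep_chainE (i j : V) :
  rep_chain M a b i j = M i j *: a j + (i == j)%:R *: b j.
Proof.
rewrite ffunE eq_sym; case: eqVneq => [->|_]; first by rewrite scale1r.
by rewrite scale0r addr0.
Qed.

(** The reindexing [g] covers both sums over all of [V] and sums over an enumeration of [X]. *)
Lemma sum_rep_chainE (I : finType) (c : I -> F) (g : I -> V) (j : V) :
  (\sum_i c i *: rep_chain M a b (g i)) j =
  (\sum_i c i * M (g i) j) *: a j + (\sum_i c i * (g i == j)%:R) *: b j.
Proof.
rewrite sum_ffunE !scaler_suml -big_split; apply: eq_bigr => i _ /=.
by rewrite ffunE rep_chainE scalerDr !scalerA.
Qed.

Lemma mem_span_rep_chain (f : chain F V) :
  f \in <<[seq rep_chain M a b i | i <- enum V]>>%VS ->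
  exists c : V -> F, f = \sum_i c i *: rep_chain M a b i.
Proof.
rewrite span_def big_map big_enum => /memv_sumP[vs vsP ->].
have /fin_all_exists[c cP] i : exists k, vs i = k *: rep_chain M a b i.
  by apply/vlineP; apply: vsP.
by exists c; apply: eq_bigr => i _.
Qed.

Lemma sum_delta_enum_val (X : {set V}) (v : 'I_#|X| -> F) (l : 'I_#|X|) :
  \sum_k v k * (enum_val k == enum_val l)%:R = v l.
Proof.
rewrite (bigD1 l) //= eqxx mulr1 big1 ?addr0 // => k kl.
by rewrite (inj_eq enum_val_inj) (negPf kl) mulr0.
Qed.

Lemma sum_delta_enum_val_out (X : {set V}) (v : 'I_#|X| -> F) (x : V) :
  x \notin X -> \sum_k v k * (enum_val k == x)%:R = 0.
Proof.
move=> xX; rewrite big1 // => k _; case: eqP => [e|_]; last by rewrite mulr0.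
by rewrite -e enum_valP in xX.
Qed.

Definition rep_comb (X : {set V}) (v : 'rV[F]_#|X|) : chain F V :=
  \sum_k v 0 k *: rep_chain M a b (enum_val k).

(** When the rows of [K] form a basis of the left kernel of $M[X, V\setminus X]$, this map
    parametrizes $N\times X$ by coordinates in that basis. *)
Definition rep_restrict (X : {set V}) (m : nat) (K : 'M[F]_(m, #|X|))
    (u : 'rV[F]_m) : chain F {x : V | x \in X} :=
  chain_restrict X (rep_comb (u *m K)).

Lemma rep_restrict_is_linear (X : {set V}) (m : nat) (K : 'M[F]_(m, #|X|)) :
  linear (@rep_restrict X m K).
Proof.
move=> c u v; rewrite /rep_restrict -linearP; congr (chain_restrict X _).
rewrite /rep_comb scaler_sumr -big_split; apply: eq_bigr => k _ /=.
by rewrite mulmxDl -scalemxAl !mxE scalerDl scalerA.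
Qed.

HB.instance Definition _ (X : {set V}) (m : nat) (K : 'M[F]_(m, #|X|)) :=
  GRing.isLinear.Build F 'rV[F]_m (chain F {x : V | x \in X}) _
    (@rep_restrict X m K) (rep_restrict_is_linear K).

(** The [b]-coefficients of the restricted chain are the entries of [u *m K], and a row-free [K] is
    injective on row vectors. *)
Lemma rep_restrict_eq0 (X : {set V}) (m : nat) (K : 'M[F]_(m, #|X|)) u :
  row_free K -> rep_restrict K u = 0 -> u = 0.
Proof.
move=> Kfree h; apply: (row_free_inj Kfree); rewrite mul0mx.
apply/rowP => l; rewrite [RHS]mxE.
move/ffunP/(_ (exist _ (enum_val l) (enum_valP l))): h.
rewrite !ffunE sum_rep_chainE /= => /supplementary_free[_].
by rewrite sum_delta_enum_val.
Qed.

Lemma dim_chain_minor (X : {set V}) :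
  (\dim (chain_minor <<[seq rep_chain M a b i | i <- enum V]>> X)
   + \rank (sub_matrix M X (~: X)) = #|X|)%N.
Proof.
set N := <<_>>%VS; set A := sub_matrix M X (~: X).
pose K := row_base (kermx A).
have Kfree : row_free K by apply: row_base_free.
have KA : K *m A = 0 by apply/sub_kermxP; rewrite eq_row_base.
suff -> : chain_minor N X = limg (linfun (rep_restrict K)).
  (* The parametrization is injective, so the dimension is the number of rows of [K], the rank of
     [kermx A]. *)
  rewrite limg_dim_eq; last first.
    apply/eqP; rewrite capfv -subv0; apply/subvP => u.
    rewrite memv_ker memv0 lfunE /= => /eqP h.
    by apply/eqP; apply: rep_restrict_eq0 h.
  by rewrite dimvf /dim /= mul1n mxrank_ker subnK // rank_leq_row.
apply/vspaceP => g; apply/chain_minorP/memv_imgP => [[f [fN f0 ->]] | [u _ ->]].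
- have [c fE] := mem_span_rep_chain fN.
  have fxE x : f x = (\sum_i c i * M i x) *: a x + c x *: b x.
    rewrite fE (sum_rep_chainE c id); congr (_ + _ *: _).
    rewrite (bigD1 x) //= eqxx mulr1 big1 ?addr0 // => i ix.
    by rewrite (negPf ix) mulr0.
  have c0 x : x \notin X -> \sum_i c i * M i x = 0 /\ c x = 0.
    by move=> xX; apply: (@supplementary_free x); rewrite -fxE f0.
  (* Since [c] vanishes off [X], sums over [V] weighted by [c] reduce to sums over the enumeration
     of [X]. *)
  have cX (G : V -> F) : \sum_(k < #|X|) c (enum_val k) * G (enum_val k)
      = \sum_i c i * G i.
    rewrite (bigID (mem X)) /= [X in _ + X]big1 ?addr0; last first.
      by move=> i /c0[_ ->]; rewrite mul0r.
    by rewrite [RHS]big_enum_val.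
  pose v : 'rV[F]_#|X| := \row_k c (enum_val k).
  (* The entries of [v *m A] are the [a]-coefficients of [f] at the points outside [X], all zero by
     [c0]. *)
  have vA : (v <= K)%MS.
    rewrite eq_row_base; apply/sub_kermxP/rowP => l; rewrite !mxE.
    have /c0[h _] : enum_val l \notin X by have := enum_valP l; rewrite inE.
    by rewrite -[RHS]h -[RHS]cX; apply: eq_bigr => k _; rewrite !mxE.
  have [u vE] := submxP vA.
  exists u; rewrite ?memvf // lfunE /= /rep_restrict -vE.
  (* The chains agree on all of [V], even before restriction; their [a]- and [b]-coefficients are
     compared separately. *)
  congr (chain_restrict X _); apply/ffunP => x; rewrite sum_rep_chainE fxE.
  congr (_ *: _ + _ *: _).
    by rewrite -[LHS]cX; apply: eq_bigr => k _; rewrite mxE.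
  have [xX|xX] := boolP (x \in X); last first.
    by rewrite sum_delta_enum_val_out // (c0 x xX).2.
  by rewrite -(enum_rankK_in xX xX) sum_delta_enum_val mxE.
- exists (rep_comb (u *m K)); split; last by rewrite lfunE.
    apply: memv_suml => k _; apply/memvZ/memv_span/map_f.
    by rewrite mem_enum.
  (* Off [X] only the [a]-coefficient remains, and it is an entry of [u *m K *m A], which is
     zero. *)
  move=> x xX; rewrite sum_rep_chainE sum_delta_enum_val_out // scale0r addr0.
  have xC : x \in ~: X by rewrite inE.
  have /rowP/(_ (enum_rank_in xC x)) : u *m K *m A = 0.
    by rewrite -mulmxA KA mulmx0.
  rewrite !mxE => h; rewrite [X in X *: _](_ : _ = 0) ?scale0r // -[RHS]h.
  by apply: eq_bigr => k _; rewrite !mxE enum_rankK_in.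
Qed.

End ChainMinorDimension.

(** Up to sign the two blocks are transposes of each other, and neither transposition nor negation
    changes the rank. *)
Lemma rank_sub_matrix_sym (F : fieldType) (V : finType) (M : V -> V -> F)
    (X Y : {set V}) :
  skew_matrix M \/ sym_matrix M ->
  \rank (sub_matrix M X Y) = \rank (sub_matrix M Y X).
Proof.
case=> [[Mskew _]|Msym]; rewrite -[RHS]mxrank_tr.
  by rewrite -[RHS]mxrank_opp; congr (\rank _); apply/matrixP => i j;
     rewrite !mxE Mskew.
by congr (\rank _); apply/matrixP => i j; rewrite !mxE Msym.
Qed.

Theorem theorem4p13 (F : fieldType) (V : finType) (s : Ksign)
    (M : V -> V -> F) (N : {vspace chain F V}) (a b : chain F V)
    (hM : skew_matrix M \/ sym_matrix M)
    (hN : lagrangian s N)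
    (hab : supplementary s a b)
    (hrep : matrix_representation s M a b N)
    (X : {set V}) :
  (\rank (sub_matrix M X (~: X)))%:R = connectivity N X /\
  connectivity N X = #|X|%:R - (\dim (chain_minor N X))%:R.
Proof.
have [_ _ NE] := hrep; have [_ dimN] := hN.
have dX := dim_chain_minor M hab X; have dC := dim_chain_minor M hab (~: X).
rewrite -NE in dX dC; rewrite setCK (rank_sub_matrix_sym _ _ hM) in dC.
have {}dX : #|X|%:R = (\dim (chain_minor N X))%:R
    + (\rank (sub_matrix M X (~: X)))%:R :> rat by rewrite -natrD dX.
have {}dC : #|~: X|%:R = (\dim (chain_minor N (~: X)))%:R
    + (\rank (sub_matrix M X (~: X)))%:R :> rat by rewrite -natrD dC.
(* Here $\dim N = |X| + |V\setminus X|$, so subtracting the two minor dimensions leaves twice the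
   rank, which the factor 1/2 halves. *)
have connE : connectivity N X = (\rank (sub_matrix M X (~: X)))%:R.
  by rewrite /connectivity dimN -(cardsC X) natrD dX dC; field.
by rewrite connE; split=> //; rewrite dX addrAC subrr add0r.
Qed.
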